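(* Let $N\ge4$, let $K_{2,N-2}$ be the complete bipartite graph with vertex groups $\{1,2\}$ and $\{3,\dots,N\}$, let $d_1=d_2=2$ and let $d_3,\dots,d_N\ge2$ be arbitrary. Let $\Bbbk$ be a field. Then the global Markov ideal $I_{\mathrm{gl}(K_{2,N-2})}$ is radical, with irredundant prime decomposition $$I_{\mathrm{gl}(K_{2,N-2})}=I_{K_{2,N-2}}\cap\bigcap P_{a,C,b,D},$$ where the intersection runs over all $a,b\in\{3,\dots,N\}$ and all nonempty proper subsets $C\subsetneq[d_a]$, $D\subsetneq[d_b]$; when $N=4$ one also requires $a=b$.
   Context: $[m]=\{1,\dots,m\}$, $\mathcal X=\prod_{v=1}^N[d_v]$, $x_W=(x_v)_{v\in W}$ for $x\in\mathcal X$. Write variables as $p_{ijK}$ with $i,j\in[2]$ (states of nodes 1,2) and $K=(K_3,\dots,K_N)\in\prod_{s=3}^N[d_s]$. Global Markov ideal of a graph $G$ on $[N]$: $I_{\mathrm{gl}(G)}\subseteq\Bbbk[p_x:x\in\mathcal X]$ is generated by all binomials $p_{x_Ax_Bx_C}p_{x'_Ax'_Bx_C}-p_{x_Ax'_Bx_C}p_{x'_Ax_Bx_C}$, where $A,B,C$ range over all partitions $[N]=A\cup B\cup C$ into disjoint (possibly empty) sets such that every path in $G$ from a vertex of $A$ to a vertex of $B$ meets $C$, and $x_A,x'_A,x_B,x'_B,x_C$ range over all states of the respective subsets. Toric ideal: $I_G$ is the kernel of $p_x\mapsto\prod_W\theta^W_{x_W}$, product over all cliques $W$ of $G$, with independent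 indeterminates $\theta^W_y$, $y\in\prod_{v\in W}[d_v]$. For $a,b\in\{3,\dots,N\}$ (possibly equal), $C\subseteq[d_a]$, $D\subseteq[d_b]$, the ideal $P_{a,C,b,D}$ is generated by $I_{\mathrm{gl}(K_{2,N-2})}$ together with the variables $$\{p_{11K}:K_a\in C\}\cup\{p_{12K}:K_b\in D\}\cup\{p_{21K}:K_b\notin D\}\cup\{p_{22K}:K_a\notin C\}.$$ *)

(* Defs.v *)
From HB Require Import structures.
From mathcomp Require Import all_boot all_order all_algebra.
From mathcomp Require Import mpoly.

Set Implicit Arguments.
Unset Strict Implicit.
Unset Printing Implicit Defensive.

Import GRing.Theory.
Local Open Scope ring_scope.

(* Ideals are Prop-valued predicates: the idealr structures of ring_quotient
   only cover ideals with a boolean membership test. *)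
Section Ideals.
Variable R : comNzRingType.
Implicit Types (S I : R -> Prop).

Definition ideal I : Prop :=
  [/\ I 0, forall f g, I f -> I g -> I (f + g)
    & forall h f, I f -> I (h * f)].

Definition ideal_gen S : R -> Prop := fun f =>
  exists s : seq (R * R),
    (forall t, t \in s -> S t.2) /\ f = \sum_(t <- s) t.1 * t.2.

Definition prime_ideal I : Prop :=
  [/\ ideal I, ~ I 1 & forall f g, I (f * g) -> I f \/ I g].

Definition radical_ideal I : Prop :=
  ideal I /\ forall f n, I (f ^+ n) -> I f.

(* I is the intersection of the prime ideals F j, for j satisfying P, and
   deleting any index j changes the intersection; in particular distinct
   indices satisfying P give distinct ideals. *)
Definition irredundant_prime_decomposition
    (I : R -> Prop) (J : finType) (P : pred J) (F : J -> R -> Prop) : Prop :=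
  [/\ forall j, P j -> prime_ideal (F j),
      forall f, I f <-> (forall j, P j -> F j f)
    & forall j, P j ->
        ~ (forall f, I f <-> (forall i, P i -> i <> j -> F i f))].

End Ideals.

Section GraphicalModels.
Variables (k : fieldType) (V : finType) (d : V -> nat).

(* The states of v are 0, ..., d v - 1 instead of 1, ..., d v. *)
Definition state : finType := {dffun forall v : V, 'I_(d v)}.

Definition state_on (W : {set V}) : finType :=
  {dffun forall v : {v : V | v \in W}, 'I_(d (val v))}.

Definition restr (W : {set V}) (x : state) : state_on W :=
  [ffun v : {v : V | v \in W} => x (val v)].

(* The state that agrees with x on A and with y outside A. *)
Definition glue (A : {set V}) (x y : state) : state :=
  [ffun v => if v \in A then x v else y v].

Definition pvar (x : state) : {mpoly k[#|state|]} := 'X_(enum_rank x).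

Definition separates (G : rel V) (A B C : {set V}) : Prop :=
  forall (a : V) (s : seq V), a \in A -> path G a s -> last a s \in B ->
    exists2 c, c \in a :: s & c \in C.

(* With x = (x_A, x_B, x_C) and x' = (x'_A, x'_B, x'_C), the four states below
   are x_A x_B x_C, x'_A x'_B x_C, x_A x'_B x_C and x'_A x_B x_C; x'_C is not
   used. *)
Definition markov_binomial (G : rel V) (f : {mpoly k[#|state|]}) : Prop :=
  exists A B C : {set V}, exists x x' : state,
    [/\ [/\ [disjoint A & B], [disjoint A & C], [disjoint B & C]
          & A :|: B :|: C = [set: V]],
        separates G A B C
      & f = pvar x * pvar (glue (A :|: B) x' x)
            - pvar (glue B x' x) * pvar (glue A x' x)].

Definition global_markov_ideal (G : rel V) : {mpoly k[#|state|]} -> Prop :=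
  ideal_gen (markov_binomial G).

Definition clique (G : rel V) (W : {set V}) : bool :=
  [forall u in W, forall v in W, (u != v) ==> G u v].

(* The indices (W, y) of the parameters theta^W_y; those with W not a clique
   are not used. *)
Definition param : finType := {W : {set V} & state_on W}.

Definition theta (W : {set V}) (y : state_on W) : {mpoly k[#|param|]} :=
  'X_(enum_rank (Tagged state_on y : param)).

Definition clique_monomial (G : rel V) (x : state) : {mpoly k[#|param|]} :=
  \prod_(W : {set V} | clique G W) theta (restr W x).

(* f \mPo [tuple ...] substitutes clique_monomial G x for p_x in f. *)
Definition toric_ideal (G : rel V) : {mpoly k[#|state|]} -> Prop := fun f =>
  f \mPo [tuple clique_monomial G (enum_val i) | i < #|state|] = 0.

End GraphicalModels.

(* The nodes 1, ..., N are the elements 0, ..., N - 1 of 'I_N. *)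
Definition K2 (N : nat) : rel 'I_N := fun u v => (u < 2)%N (+) (v < 2)%N.

Definition node1 (N : nat) (hN : (4 <= N)%N) : 'I_N :=
  Ordinal (leq_trans (isT : 0 < 4)%N hN).
Definition node2 (N : nat) (hN : (4 <= N)%N) : 'I_N :=
  Ordinal (leq_trans (isT : 1 < 4)%N hN).

Section Components.
Variables (k : fieldType) (N : nat) (hN : (4 <= N)%N) (d : 'I_N -> nat).

(* The variables p_ijK among the generators of P_{a,C,b,D}; the states 1 and 2
   of the nodes 1 and 2 are the ordinals 0 and 1. *)
Definition vanishing_state (a : 'I_N) (C : {set 'I_(d a)})
    (b : 'I_N) (D : {set 'I_(d b)}) (x : state d) : bool :=
  let is_ij (i j : nat) :=
    (x (node1 hN) == i :> nat) && (x (node2 hN) == j :> nat) in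
  [|| is_ij 0 0 && (x a \in C), is_ij 0 1 && (x b \in D),
      is_ij 1 0 && (x b \notin D) | is_ij 1 1 && (x a \notin C)]%N.

Definition P_ideal (a : 'I_N) (C : {set 'I_(d a)})
    (b : 'I_N) (D : {set 'I_(d b)}) : {mpoly k[#|state d|]} -> Prop :=
  ideal_gen (fun f =>
    global_markov_ideal (@K2 N) f \/
    exists2 x : state d, vanishing_state C D x & f = pvar k x).

(* A pair (a, C) with C a set of states of the node a. *)
Definition node_set : finType := {a : 'I_N & {set 'I_(d a)}}.

Definition proper_node_set (q : node_set) : bool :=
  [&& (2 <= tag q)%N, tagged q != set0 & tagged q \proper [set: 'I_(d (tag q))]].

(* The index None stands for the toric ideal and Some ((a, C), (b, D)) for
   P_{a,C,b,D}. *)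
Definition component_index : finType := option (node_set * node_set).

Definition admissible (j : component_index) : bool :=
  if j is Some (q, r) then
    [&& proper_node_set q, proper_node_set r & (N == 4) ==> (tag q == tag r)]
  else true.

Definition component (j : component_index) : {mpoly k[#|state d|]} -> Prop :=
  if j is Some (q, r) then P_ideal (tagged q) (tagged r)
  else toric_ideal (@K2 N).

End Components.

(* Main.v *)
(* Modulo the Markov binomials with C = {1, 2}, a monomial is determined by its
   exponents e^{ij}_{v,c} (Segre): the number of its factors p_{ijK} with
   K_v = c. The remaining quadrics p_{11K} p_{22K} - p_{12K} p_{21K} move one
   unit from e^{11}, e^{22} to e^{12}, e^{21} along K. In a toric fibre, a
   monomial to which some quadric applies is joined to every other one. A
   monomial to which none applies has nodes a, b where the supports of e^{11}_a
   and e^{22}_a, and those of e^{12}_b and e^{21}_b, are disjoint. Either it is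
   determined by its toric fibre (one block is empty, or {a, b} = {3, 4} and
   N = 4), or C = supp e^{22}_a and D = supp e^{21}_b give a component
   P_{a,C,b,D} not containing it, modulo which only its Segre class is
   identified with it. So a polynomial in all components has coefficient sum 0
   on each Markov class. Each component is prime as the kernel of a monomial
   map to a polynomial ring. For irredundancy, the product of all variables lies
   in every P_{a,C,b,D}, and the product of the variables not in P_{a,C,b,D}
   lies in all the other ones; multiply it by a toric binomial outside
   P_{a,C,b,D}. *)
Require Import Defs.
From HB Require Import structures.
From mathcomp Require Import all_boot all_order all_algebra.
From mathcomp Require Import mpoly zify ring.

Set Implicit Arguments.
Unset Strict Implicit.
Unset Printing Implicit Defensive.

Import GRing.Theory.
Local Open Scope ring_scope.

(** * Ideals *)

Section IdealTheory.
Variable R : comNzRingType.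
Implicit Types (S I J : R -> Prop) (f g : R).

Lemma ideal_opp I f : ideal I -> I f -> I (- f).
Proof. by move=> [_ _ IM] If; rewrite -mulN1r; apply: IM. Qed.

Lemma ideal_sub I f g : ideal I -> I f -> I g -> I (f - g).
Proof. by move=> idI If Ig; case: (idI) => _ ID _; apply: ID => //; apply: ideal_opp. Qed.

Lemma ideal_mulr I f g : ideal I -> I f -> I (f * g).
Proof. by move=> [_ _ IM] If; rewrite mulrC; apply: IM. Qed.

Lemma ideal_sum I (T : eqType) (r : seq T) (P : pred T) (F : T -> R) :
  ideal I -> (forall i, i \in r -> P i -> I (F i)) -> I (\sum_(i <- r | P i) F i).
Proof.
move=> [I0 ID _] IF; rewrite big_seq_cond.
by elim/big_ind: _ => [|f g|i /andP[ir Pi]]; [|exact: ID|exact: IF].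
Qed.

Lemma ideal_genP S : ideal (ideal_gen S).
Proof.
split=> [|f g [s [Ss ->]] [t [St ->]]|h f [s [Ss ->]]].
- by exists [::]; rewrite big_nil.
- exists (s ++ t); rewrite big_cat; split=> // u.
  by rewrite mem_cat => /orP[/Ss|/St].
- exists [seq (h * u.1, u.2) | u <- s]; split=> [_ /mapP[u us ->]|]; first exact: (Ss u).
  by rewrite big_map mulr_sumr; apply: eq_bigr => u _; rewrite mulrA.
Qed.

Lemma sub_ideal_gen S f : S f -> ideal_gen S f.
Proof.
by move=> Sf; exists [:: (1, f)]; rewrite big_seq1 mul1r; split=> // t; rewrite inE => /eqP->.
Qed.

Lemma ideal_gen_min S J f :
  ideal J -> (forall g, S g -> J g) -> ideal_gen S f -> J f.
Proof.
move=> idJ SJ [s [Ss ->]]; apply: ideal_sum => // t ts _.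
by case: idJ => _ _ JM; apply/JM/SJ/Ss.
Qed.

Lemma prime_ideal_radical I f n : prime_ideal I -> I (f ^+ n) -> I f.
Proof.
move=> [idI I1 Ipr]; elim: n => [|n IHn]; first by rewrite expr0 => /I1.
by rewrite exprS => /Ipr[].
Qed.

End IdealTheory.

(** * Monomial substitutions *)

Section Substitution.
Variables (k : fieldType) (V : finType) (d : V -> nat) (M : nat).
Local Notation st := (state d).
Local Notation Rp := {mpoly k[#|state d|]}.
Implicit Types (phi : st -> {mpoly k[M]}) (f g : Rp) (s t : seq st).
Implicit Types (m : 'X_{1..#|state d|}).

(** A monomial is handled as the list of its factors, so that a Markov move acts on list entries. *)
Definition mon s : Rp := \prod_(x <- s) pvar k x.

Lemma pvarM x y : pvar k x * pvar k y = mon [:: x; y].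
Proof. by rewrite /mon big_cons big_seq1. Qed.

Definition seq_of m : seq st :=
  flatten [seq nseq (m i) (enum_val i) | i <- enum 'I_#|state d|].

Lemma mon_seq_of m : mon (seq_of m) = 'X_[m].
Proof.
rewrite mpolyXE_id /mon /seq_of big_flatten big_map big_enum /=.
by apply: eq_bigr => i _; rewrite big_nseq -Monoid.iteropE /pvar enum_valK.
Qed.

Definition subst phi f : {mpoly k[M]} := f \mPo [tuple phi (enum_val i) | i < #|state d|].

Lemma subst_mon phi s : subst phi (mon s) = \prod_(x <- s) phi x.
Proof.
rewrite /subst /mon rmorph_prod; apply: eq_bigr => x _.
by rewrite /= /pvar comp_mpolyXU -tnth_nth tnth_mktuple enum_rankK.
Qed.

Lemma substB phi f g : subst phi (f - g) = subst phi f - subst phi g.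
Proof. exact: comp_mpolyB. Qed.

Lemma substM phi f g : subst phi (f * g) = subst phi f * subst phi g.
Proof. exact: rmorphM. Qed.

Lemma ker_prime phi : prime_ideal (fun f => subst phi f = 0).
Proof.
split; first split.
- exact: comp_mpoly0.
- by move=> f g f0 g0; rewrite /subst comp_mpolyD [_ \mPo _]f0 [X in 0 + X]g0 addr0.
- by move=> h f f0; rewrite substM f0 mulr0.
- by rewrite /subst comp_mpoly1 => /eqP; rewrite oner_eq0.
- by move=> f g /eqP; rewrite substM mulf_eq0 => /orP[] /eqP; [left|right].
Qed.

Lemma subst_monomial phi s :
  (forall x, phi x = 0 \/ exists w, phi x = 'X_[w]) ->
  subst phi (mon s) = 0 \/ exists w, subst phi (mon s) = 'X_[w].
Proof.
move=> phiE; rewrite subst_mon; elim/big_ind: _ => [|f g Hf Hg|x _]; last exact: phiE.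
  by right; exists 0%MM; rewrite mpolyX0.
case: Hf => [->|[u ->]]; first by left; rewrite mul0r.
case: Hg => [->|[v ->]]; first by left; rewrite mulr0.
by right; exists (u + v)%MM; rewrite mpolyXD.
Qed.

(** All monomials of the fibre map to one ['X_[w]], every other one to 0 or to a different monomial.
    The sum is thus the coefficient of ['X_[w]] in [subst phi f]. *)
Lemma ker_fiber_sum phi f m0 :
  (forall x, phi x = 0 \/ exists w, phi x = 'X_[w]) ->
  subst phi f = 0 -> subst phi 'X_[m0] != 0 ->
  \sum_(m <- msupp f | subst phi 'X_[m] == subst phi 'X_[m0]) f@_m = 0.
Proof.
move=> phiE f0 m0N0.
have monE m : subst phi 'X_[m] = 0 \/ exists w, subst phi 'X_[m] = 'X_[w].
  by rewrite -mon_seq_of; apply: subst_monomial.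
case: (monE m0) m0N0 => [->|[w ->] _]; first by rewrite eqxx.
have fE : subst phi f = \sum_(m <- msupp f) subst phi (f@_m *: 'X_[m]).
  by rewrite {1}(mpolyE f); apply: raddf_sum.
have := congr1 (mcoeff w) f0; rewrite mcoeff0 fE (raddf_sum (mcoeff w)) /=.
move=> E; apply: etrans E; rewrite big_mkcond; apply: eq_bigr => m _; rewrite /subst.
rewrite comp_mpolyZ mcoeffZ -/(subst phi 'X_[m]).
case: (monE m) => [->|[u ->]].
  by rewrite mcoeff0 mulr0 eq_sym -msupp_eq0 msuppX.
rewrite mcoeffX; case: (eqVneq u w) => [->|uw]; first by rewrite eqxx mulr1.
rewrite mulr0; case: eqP => // /(congr1 (mcoeff w)).
by rewrite !mcoeffX eqxx (negbTE uw) => /eqP; rewrite eq_sym oner_eq0.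
Qed.

(* Q is the fibre of m under a map killing J; the terms of f in a fibre are
   removed one fibre at a time. *)
Lemma ideal_by_fibers (I J : Rp -> Prop) :
  ideal I -> ideal J -> (forall f, I f -> J f) ->
  (forall m, I 'X_[m] \/ exists Q : pred 'X_{1..#|state d|},
     [/\ Q m, forall m', Q m' -> I ('X_[m'] - 'X_[m])
       & forall f, J f -> \sum_(m' <- msupp f | Q m') f@_m' = 0]) ->
  forall f, J f -> I f.
Proof.
move=> idI idJ IJ fib f; move: {2}_.+1 (ltnSn (size (msupp f))) => n.
elim: n f => // n IHn f; rewrite ltnS => le_n Jf.
case: (eqVneq f 0) => [->|fN0]; first by case: idI.
have : exists m, m \in msupp f.
  by move: fN0; rewrite -msupp_eq0; case: (msupp f) => // m *; exists m; rewrite inE eqxx.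
move=> [m mf].
(* Removing the terms in [Q] creates no new term and removes [m], so the support shrinks and the
   induction applies. *)
suff [Q [Qm IQ]] : exists Q : pred 'X_{1..#|state d|},
    Q m /\ I (\sum_(m' <- msupp f | Q m') f@_m' *: 'X_[m']).
  set g := BIG_F in IQ; set G := \sum_(_ <- _ | _) _ in IQ.
  have fg : f - G = \sum_(m' <- msupp f | ~~ Q m') f@_m' *: 'X_[m'].
    by rewrite {1}(mpolyE f) (bigID Q) /= addrC addrK.
  have If : I (f - G).
    apply: IHn; last by apply: ideal_sub => //; apply: IJ.
    apply: leq_trans le_n.
    have sub u : u \in msupp (f - G) -> u \in [seq m' <- msupp f | ~~ Q m'].
      rewrite mcoeff_msupp fg raddf_sum /= => uN0; rewrite mem_filter.
      apply: contraNT uN0 => uQ; rewrite big_seq_cond big1 // => m' /andP[m'f Qm'].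
      rewrite mcoeffZ mcoeffX; case: eqP => [E|]; last by rewrite mulr0.
      by rewrite -E Qm' m'f in uQ.
    apply: leq_ltn_trans (uniq_leq_size (msupp_uniq _) sub) _.
    rewrite size_filter -(count_predC Q (msupp f)) -[X in (X < _)%N]add0n ltn_add2r.
    by rewrite -has_count; apply/hasP; exists m.
  by rewrite -(subrK G f); case: (idI) => _ ID _; apply: ID.
case: (fib m) => [Im|[Q [Qm QI QJ]]].
  exists (pred1 m); split; first exact: eqxx.
  apply: ideal_sum => // m' _ /eqP->.
  by rewrite -mul_mpolyC; case: idI => _ _; apply.
exists Q; split=> //.
(* The coefficients on [Q] sum to 0, so subtracting ['X_[m]] from each monomial leaves the sum
   unchanged. *)
suff -> : \sum_(m' <- msupp f | Q m') f@_m' *: 'X_[m'] =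
          \sum_(m' <- msupp f | Q m') f@_m' *: ('X_[m'] - 'X_[m]).
  apply: ideal_sum => // m' _ Qm'.
  by rewrite -mul_mpolyC; case: (idI) => _ _; apply; apply: QI.
under [RHS]eq_bigr do rewrite scalerBr.
by rewrite sumrB -scaler_suml QJ // scale0r subr0.
Qed.

End Substitution.

(** Equal monomials have equal exponents, and the additive weight [wt] of the exponents counts the
    variables that satisfy [q]. *)
Lemma prod_vars_count (k : fieldType) (T S P : finType) (g : T -> S -> P)
    (C : pred S) (q : pred P) (s t : seq T) :
  \prod_(x <- s) \prod_(i | C i) 'X_(enum_rank (g x i)) =
  \prod_(x <- t) \prod_(i | C i) 'X_(enum_rank (g x i)) :> {mpoly k[#|P|]} ->
  (\sum_(x <- s) \sum_(i | C i) q (g x i) = \sum_(x <- t) \sum_(i | C i) q (g x i))%N.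
Proof.
pose wt (m : 'X_{1..#|P|}) := (\sum_j m j * q (enum_val j))%N.
have wtD m m' : wt (m + m')%MM = (wt m + wt m')%N.
  by rewrite /wt -big_split; apply: eq_bigr => j _; rewrite mnmDE mulnDl.
have wt0 : wt 0%MM = 0%N by rewrite /wt big1 // => j _; rewrite mnm0E.
have prodE u : \prod_(x <- u) \prod_(i | C i) 'X_(enum_rank (g x i)) =
   'X_[\big[+%MM/0%MM]_(x <- u) \big[+%MM/0%MM]_(i | C i) U_(enum_rank (g x i))%MM]
      :> {mpoly k[#|P|]}.
  rewrite (big_morph _ (@mpolyXD _ _) (@mpolyX0 _ _)); apply: eq_bigr => x _.
  by rewrite (big_morph _ (@mpolyXD _ _) (@mpolyX0 _ _)).
have wtE u : wt (\big[+%MM/0%MM]_(x <- u) \big[+%MM/0%MM]_(i | C i) U_(enum_rank (g x i)))%MM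
    = (\sum_(x <- u) \sum_(i | C i) q (g x i))%N.
  rewrite (big_morph _ wtD wt0); apply: eq_bigr => x _.
  rewrite (big_morph _ wtD wt0); apply: eq_bigr => i _.
  rewrite /wt (bigD1 (enum_rank (g x i))) //= mnm1E eqxx enum_rankK mul1n big1 ?addn0 //.
  by move=> j /negbTE ji; rewrite mnm1E eq_sym ji.
rewrite -!wtE !prodE => E; congr wt; apply/eqP; move/(congr1 (mcoeff
  (\big[+%MM/0%MM]_(x <- s) \big[+%MM/0%MM]_(i | C i) U_(enum_rank (g x i)))%MM)): E.
rewrite !mcoeffX eqxx eq_sym; case: (_ == _) => // /eqP.
by rewrite oner_eq0.
Qed.

Lemma neq0_inj2 (a b : nat) : (a < 2)%N -> (b < 2)%N -> (a != 0%N) = (b != 0%N) -> a = b.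
Proof. by case: a => [|[]] //; case: b => [|[]]. Qed.

(** * Markov binomials *)

(** Each [W i] misses [A] or [B], so on it the two states of the left side coincide, in some order,
    with those of the right side. Both the toric map and the Segre maps are treated this way. *)
Lemma prod_glue (R : comNzRingType) (V : finType) (d : V -> nat) (T : finType)
    (C : pred T) (W : T -> {set V}) (F : T -> state d -> R) (A B : {set V})
    (x x' : state d) :
  (forall i (y z : state d), C i -> (forall v, v \in W i -> y v = z v) -> F i y = F i z) ->
  (forall i, C i -> [disjoint W i & A] || [disjoint W i & B]) ->
  (\prod_(i | C i) F i x) * (\prod_(i | C i) F i (glue (A :|: B) x' x)) =
  (\prod_(i | C i) F i (glue B x' x)) * (\prod_(i | C i) F i (glue A x' x)).
Proof.
move=> FW WAB; rewrite -!big_split; apply: eq_bigr => i Ci /=.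
have /orP[/disjointFr WA|/disjointFr WB] := WAB i Ci.
  rewrite mulrC; congr (_ * _); apply: FW => // v vW; rewrite !ffunE ?inE WA //.
by congr (_ * _); apply: FW => // v vW; rewrite !ffunE ?inE WB ?orbF.
Qed.

(** A path from [A] to [B] has at least one edge by disjointness, and its second vertex already lies
    in [C]. *)
Lemma separates_neighbours (V : finType) (G : rel V) (A B C : {set V}) :
  [disjoint A & B] -> (forall u v, u \in A -> G u v -> v \in C) -> separates G A B C.
Proof.
move=> dAB nbr a [|b s] aA /= => [_ aB|/andP[Gab _] _]; first by rewrite (disjointFr dAB aA) in aB.
by exists b; [rewrite !inE eqxx orbT|apply: nbr Gab].
Qed.

Lemma separates_edge (V : finType) (G : rel V) (A B C : {set V}) u v :
  [disjoint A & C] -> [disjoint B & C] -> separates G A B C ->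
  u \in A -> v \in B -> ~~ G u v.
Proof.
move=> dAC dBC sep uA vB; apply/negP => Guv.
have [||c] := sep u [:: v] uA; rewrite /= ?Guv // !inE => /orP[]/eqP-> cC.
  by rewrite (disjointFr dAC uA) in cC.
by rewrite (disjointFr dBC vB) in cC.
Qed.

(** A clique meeting both [A] and [B] would contain an edge that avoids [C]. *)
Lemma markov_binomial_toric (k : fieldType) (V : finType) (d : V -> nat) (G : rel V) f :
  markov_binomial G f -> @toric_ideal k V d G f.
Proof.
move=> [A [B [C [x [x' [[dAB dAC dBC _] sep ->]]]]]].
rewrite /toric_ideal -/(subst _ _) substB !pvarM !subst_mon !big_cons !big_nil !mulr1.
apply/eqP; rewrite subr_eq0; apply/eqP.
apply: (@prod_glue _ _ _ _ (clique G) id (fun W y => theta k (restr W y))).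
  move=> W y z _ yz; by congr theta; apply/ffunP => v; rewrite !ffunE; apply/yz/valP.
move=> W /forallP clW; apply/norP => -[/pred0Pn[u /= /andP[uW uA]] /pred0Pn[v /= /andP[vW vB]]].
move: (clW u); rewrite uW /= => /forallP/(_ v); rewrite vW /= (negbTE (separates_edge dAC dBC sep uA vB)).
rewrite implybF negbK => /eqP E.
by move: vB; rewrite -E (disjointFr dAB uA).
Qed.

(** * Comparison of finite sums *)

Lemma ltn_sum1 (T : finType) (P : pred T) (F G : T -> nat) (u : T) :
  (forall i, P i -> F i <= G i)%N -> P u -> (F u < G u)%N ->
  (\sum_(i | P i) F i < \sum_(i | P i) G i)%N.
Proof.
move=> FG Pu lt; rewrite (bigD1 u Pu) [X in (_ < X)%N](bigD1 u Pu) /= -addSn.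
by apply: leq_add => //; apply: leq_sum => i /andP[/FG].
Qed.

Lemma sum_eq_exists_lt (T : finType) (F G : T -> nat) :
  (\sum_i F i = \sum_i G i)%N -> ~~ [forall i, F i == G i] -> exists i, (F i < G i)%N.
Proof.
move=> eqFG; rewrite negb_forall => /existsP[i FGi]; apply/existsP.
apply: contraPT eqFG; rewrite negb_exists => /forallP le.
have leGF j : (G j <= F j)%N by rewrite leqNgt.
have lti : (G i < F i)%N by rewrite ltn_neqAle leGF eq_sym FGi.
by have := @ltn_sum1 _ predT G F i (fun j _ => leGF j) isT lti => /[swap] ->; rewrite ltnn.
Qed.

Lemma leq_sum_eq (T : finType) (F G : T -> nat) :
  (forall i, F i <= G i)%N -> (\sum_i G i <= \sum_i F i)%N -> F =1 G.
Proof.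
move=> FG le i; apply/eqP; rewrite eqn_leq FG leqNgt /=.
apply: contraL le => lt; rewrite -ltnNge.
exact: (@ltn_sum1 _ predT F G i (fun j _ => FG j) isT lt).
Qed.

(** * The bipartite graph *)

Section K2.
Variables (k : fieldType) (N : nat) (hN : (4 <= N)%N) (d : 'I_N -> nat).
Hypothesis hd12 : forall v : 'I_N, (v < 2)%N -> d v = 2.
Hypothesis hd : forall v : 'I_N, (2 <= v)%N -> (2 <= d v)%N.
Local Notation st := (state d).
Local Notation n1 := (node1 hN).
Local Notation n2 := (node2 hN).
Local Notation n3 := (Ordinal (leq_trans (isT : 2 < 4)%N hN)).
Local Notation I := (@global_markov_ideal k 'I_N d (@K2 N)).
Implicit Types (x y z K : st) (s t l : seq st) (u v w a b : 'I_N) (A : {set 'I_N}).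
Implicit Types (i j p e : bool).

Lemma global_markov_idealP : ideal I. Proof. exact: ideal_genP. Qed.

Lemma left_nodeE v : (v < 2)%N -> v = n1 \/ v = n2.
Proof. by case: v => [[|[|//]] lt] _; [left|right]; apply: val_inj. Qed.

(** Since nodes 1 and 2 are binary, a boolean records their state faithfully: [false] is the state
    1, [true] the state 2. *)
Definition st1 x : bool := x n1 != 0 :> nat.
Definition st2 x : bool := x n2 != 0 :> nat.

Lemma state_left x v : (v < 2)%N -> (x v < 2)%N.
Proof. by move=> v1; apply: leq_trans (ltn_ord (x v)) _; rewrite hd12. Qed.

Lemma st1_inj x y : st1 x = st1 y -> x n1 = y n1.
Proof. by move/neq0_inj2 => E; apply/val_inj/E; apply: state_left. Qed.

Lemma st2_inj x y : st2 x = st2 y -> x n2 = y n2.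
Proof. by move/neq0_inj2 => E; apply/val_inj/E; apply: state_left. Qed.

Lemma st_left x y v : (v < 2)%N -> st1 x = st1 y -> st2 x = st2 y -> x v = y v.
Proof. by move=> /left_nodeE[]-> ? ?; [apply: st1_inj|apply: st2_inj]. Qed.

Lemma st_eq x y : st1 x = st1 y -> st2 x = st2 y ->
  (forall v, (2 <= v)%N -> x v = y v) -> x = y.
Proof.
move=> E1 E2 E; apply/ffunP => v; case: (leqP 2 v) => [/E//|lt].
exact: st_left.
Qed.

(** * Congruence modulo the Markov ideal and Segre classes *)

Definition cong s t : Prop := I (mon k s - mon k t).

Lemma cong_perm s t : perm_eq s t -> cong s t.
Proof. by move=> /(perm_big _) E; rewrite /cong /mon E subrr; case: global_markov_idealP. Qed.

Lemma cong_refl s : cong s s. Proof. exact: cong_perm. Qed.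

Lemma cong_sym s t : cong s t -> cong t s.
Proof. by move=> /(ideal_opp global_markov_idealP); rewrite opprB. Qed.

Lemma cong_trans t s l : cong s t -> cong t l -> cong s l.
Proof.
by move=> st tr; rewrite /cong -(subrKA (mon k t)); case: global_markov_idealP => _ ID _; apply: ID.
Qed.

Lemma cong_cat l s t : cong s t -> cong (s ++ l) (t ++ l).
Proof. move=> st; rewrite /cong /mon !big_cat -mulrBl; apply: ideal_mulr global_markov_idealP st. Qed.

(* The exponents of the Segre parametrization of mon s. *)
Definition cnt s i j v (c : nat) : nat :=
  count (fun x => [&& st1 x == i, st2 x == j & x v == c :> nat]) s.

Lemma cnt_cons x s i j v c :
  cnt (x :: s) i j v c = ([&& st1 x == i, st2 x == j & x v == c :> nat] + cnt s i j v c)%N.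
Proof. by []. Qed.

Lemma cnt_perm s t i j v c : perm_eq s t -> cnt s i j v c = cnt t i j v c.
Proof. by move/permP; apply. Qed.

Definition same_cnt s t : Prop :=
  forall i j v c, (2 <= v)%N -> cnt s i j v c = cnt t i j v c.

(* Exchanging the states of one node v >= 3 between two factors with the same
   states of nodes 1 and 2: the separation of v from the other such nodes by
   {1, 2}. *)
Lemma cong_swap v y z l : (2 <= v)%N -> st1 y = st1 z -> st2 y = st2 z ->
  cong (y :: z :: l) (glue [set v] z y :: glue [set v] y z :: l).
Proof.
move=> v2 E1 E2; rewrite -[y :: _]/([:: y; z] ++ l) -[glue _ z y :: _]/([:: _; _] ++ l).
apply: cong_cat; apply: sub_ideal_gen.
exists [set v], [set u : 'I_N | (2 <= u)%N && (u != v)], [set u : 'I_N | (u < 2)%N], y, z.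
have dAB : [disjoint [set v] & [set u : 'I_N | (2 <= u)%N && (u != v)]].
  by rewrite disjoints1 !inE eqxx andbF.
split; first split=> //.
- by rewrite disjoints1 inE -leqNgt.
- by apply/pred0P => u; rewrite /= !inE [(u < 2)%N]ltnNge; case: (1 < u)%N; rewrite ?andbF.
- apply/setP => u; rewrite !inE; case: (eqVneq u v) => //= _; rewrite andbT.
  by case: leqP.
- by apply: separates_neighbours => // u w; rewrite !inE /K2 => /eqP->; rewrite ltnNge v2.
(* As [y] and [z] agree on nodes 1 and 2, exchanging all other nodes turns [y] into [z], and
   exchanging all but [v] gives [z] with the state of [y] at [v]. *)
rewrite /mon !big_cons !big_nil !mulr1 [X in _ - X]mulrC; congr (_ * pvar k _ - pvar k _ * _).
  apply/ffunP => u; rewrite !ffunE !inE; case: (eqVneq u v) => //= _; rewrite andbT.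
  by case: leqP => // lt; apply: st_left.
apply/ffunP => u; rewrite !ffunE !inE; case: (eqVneq u v) => [->|] /=; rewrite ?andbF ?andbT // => _.
by case: leqP => // lt; apply: st_left.
Qed.

Lemma st1_glue A x y : st1 (glue A x y) = if n1 \in A then st1 x else st1 y.
Proof. by rewrite /st1 ffunE; case: ifP. Qed.

Lemma st2_glue A x y : st2 (glue A x y) = if n2 \in A then st2 x else st2 y.
Proof. by rewrite /st2 ffunE; case: ifP. Qed.

Lemma st_glue1 v x y : (2 <= v)%N ->
  st1 (glue [set v] x y) = st1 y /\ st2 (glue [set v] x y) = st2 y.
Proof.
move=> v2; rewrite st1_glue st2_glue !inE.
by case: eqP => [E|_]; [rewrite -E in v2|case: eqP => [E|_] //; rewrite -E in v2].
Qed.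

Lemma same_cnt_swap v y z l : (2 <= v)%N -> st1 y = st1 z -> st2 y = st2 z ->
  same_cnt (y :: z :: l) (glue [set v] z y :: glue [set v] y z :: l).
Proof.
move=> v2 E1 E2 i j w c w2; rewrite !cnt_cons.
rewrite !(st_glue1 _ _ v2).1 !(st_glue1 _ _ v2).2 E1 E2 !ffunE !inE.
by case: (eqVneq w v) => [->|//]; rewrite addnCA.
Qed.

(** Start from any factor in the block of [x] and correct its nodes one at a time, each time
    swapping with a factor of the same block that has the wanted state. *)
Lemma extract s x : (forall v, (2 <= v)%N -> (0 < cnt s (st1 x) (st2 x) v (x v))%N) ->
  exists2 l, cong s (x :: l) & same_cnt s (x :: l).
Proof.
move=> pos.
have ext (vs : seq 'I_N) : exists y l, [/\ st1 y = st1 x, st2 y = st2 x,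
   forall v, v \in vs -> (2 <= v)%N -> y v = x v, cong s (y :: l) & same_cnt s (y :: l)].
  elim: vs => [|v vs [y [l [y1 y2 yx sy syc]]]].
    have /pos : (2 <= Ordinal (leq_trans (isT : 2 < 4)%N hN))%N by [].
    rewrite -has_count => /hasP[y ys /and3P[/eqP y1 /eqP y2 _]].
    have sp := perm_to_rem ys.
    exists y, (rem y s); split=> //; first exact: cong_perm.
    by move=> *; apply: cnt_perm.
  case: (leqP 2 v) => [v2|lt]; last first.
    exists y, l; split=> // w; rewrite inE => /orP[/eqP->|]; last exact: yx.
    by rewrite leqNgt lt.
  case: (eqVneq (y v) (x v)) => [yv|yv].
    by exists y, l; split=> // w; rewrite inE => /orP[/eqP->|]; [|exact: yx].
  (* The current factor [y] has the wrong state at [v], so the wanted one occurs in [l]. *)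
  have := pos v v2; rewrite syc // cnt_cons.
  have -> : (y v == x v :> nat) = false by apply: contraNF yv => /eqP/val_inj->.
  rewrite !andbF add0n -has_count => /hasP[z zr /and3P[/eqP z1 /eqP z2 /eqP/val_inj zv]].
  have rp := perm_to_rem zr.
  have yrp : perm_eq (y :: l) (y :: z :: rem z l) by rewrite perm_cons.
  have E1 : st1 y = st1 z by rewrite y1 z1.
  have E2 : st2 y = st2 z by rewrite y2 z2.
  exists (glue [set v] z y), (glue [set v] y z :: rem z l); split.
  - by rewrite (st_glue1 _ _ v2).1.
  - by rewrite (st_glue1 _ _ v2).2.
  - move=> w; rewrite inE ffunE inE; case: (eqVneq w v) => [->//|_] /= wvs w2.
    exact: yx.
  - apply: cong_trans sy _; apply: cong_trans (cong_perm yrp) _; exact: cong_swap.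
  - by move=> *; rewrite syc // (cnt_perm _ _ _ _ yrp); apply: same_cnt_swap.
case: (ext (enum 'I_N)) => y [l [y1 y2 yx sy syc]].
have <- : y = x by apply: st_eq => // v; apply: yx; rewrite mem_enum.
by exists l.
Qed.

(** Segre ideals are generated by their quadrics: the factors of [t] are extracted from [s] one
    after the other, and the remainders keep equal counts. *)
Lemma same_cnt_cong s t : same_cnt s t -> cong s t.
Proof.
have w2 : (2 <= Ordinal (leq_trans (isT : 2 < 4)%N hN))%N by [].
elim: t s => [|x t IHt] s sc.
  case: s sc => [|y s] sc; first exact: cong_refl.
  by have := sc (st1 y) (st2 y) _ (y (Ordinal (leq_trans (isT : 2 < 4)%N hN))) w2; rewrite cnt_cons !eqxx.
have [|l sr src] := @extract s x; first by move=> *; rewrite sc // cnt_cons !eqxx.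
apply: cong_trans sr _; rewrite -cat1s -[x :: t]cat1s.
apply: cong_trans (cong_perm _) (cong_trans (cong_cat [:: x] (IHt l _)) (cong_perm _)).
- by rewrite perm_catC.
- by move=> i j v c v2; apply/eqP; rewrite -(eqn_add2l (
    [&& st1 x == i, st2 x == j & x v == c :> nat])) -!cnt_cons -src // sc.
- by rewrite perm_catC.
Qed.

(* Meaningful for e < d v only. *)
Definition set_node v (e : nat) K : st :=
  [ffun u => if u == v then insubd (K u) e else K u].

Lemma set_nodeE v (e : nat) K : (e < d v)%N -> set_node v e K v = e :> nat.
Proof. by move=> lt; rewrite ffunE eqxx val_insubd lt. Qed.

Lemma set_node_neq v (e : nat) K u : u != v -> set_node v e K u = K u.
Proof. by rewrite ffunE => /negbTE->. Qed.

Definition set12 i j K : st := set_node n1 i (set_node n2 j K).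

Lemma st1_set12 i j K : st1 (set12 i j K) = i.
Proof. by rewrite /st1 set_nodeE ?hd12 //; case: i. Qed.

Lemma st2_set12 i j K : st2 (set12 i j K) = j.
Proof. by rewrite /st2 set_node_neq // set_nodeE ?hd12 //; case: j. Qed.

Lemma set12_right i j K v : (2 <= v)%N -> set12 i j K v = K v.
Proof.
by move=> v2; rewrite !set_node_neq //; apply/eqP => E; rewrite E in v2.
Qed.

(* The separation of node 1 from node 2 by the other nodes. *)
Lemma cong_quadric p K l :
  cong (set12 false p K :: set12 true (~~ p) K :: l)
       (set12 false (~~ p) K :: set12 true p K :: l).
Proof.
rewrite -[_ :: _]/([:: set12 false p K; set12 true (~~ p) K] ++ l).
rewrite -[X in cong _ X]/([:: set12 false (~~ p) K; set12 true p K] ++ l).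
apply: cong_cat; apply: sub_ideal_gen.
exists [set n1], [set n2], [set u : 'I_N | (2 <= u)%N], (set12 false p K), (set12 true (~~ p) K).
have dAB : [disjoint [set n1] & [set n2]] by rewrite disjoints1 inE.
split; first split=> //.
- by rewrite disjoints1 inE.
- by rewrite disjoints1 inE.
- apply/setP => u; rewrite !inE; case: (leqP 2 u) => [|/left_nodeE[]->]; by rewrite ?eqxx ?orbT.
- by apply: separates_neighbours => // u w; rewrite !inE /K2 => /eqP->; rewrite [(1 < w)%N]leqNgt.
rewrite /mon !big_cons !big_nil !mulr1.
congr (_ * pvar k _ - pvar k _ * pvar k _); apply: st_eq;
  rewrite ?st1_glue ?st2_glue ?inE /= ?st1_set12 ?st2_set12 //;
  by move=> v v2; rewrite [glue _ _ _ _]ffunE !set12_right ?if_same.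
Qed.

(** * Connectivity of toric fibres *)

(* Equality of the exponents of the edge parameters of nodes 1 and 2 in the
   toric parametrization. *)
Definition same_toric s t : Prop := forall v (c : nat), (2 <= v)%N ->
  (forall i, cnt s i false v c + cnt s i true v c = cnt t i false v c + cnt t i true v c)%N /\
  (forall j, cnt s false j v c + cnt s true j v c = cnt t false j v c + cnt t true j v c)%N.

(** Both factors of a quadric along [K] can be extracted, then replaced. The indicators stand on
    both sides of the equation to avoid truncated subtraction. *)
Lemma exchange p K s :
  (forall v, (2 <= v)%N -> (0 < cnt s false p v (K v))%N /\ (0 < cnt s true (~~ p) v (K v))%N) ->
  exists2 s1, cong s s1 & forall i j v c, (2 <= v)%N ->
    (cnt s1 i j v c + ((i (+) j == p) && (K v == c :> nat)) =
     cnt s i j v c + ((i (+) j != p) && (K v == c :> nat)))%N.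
Proof.
move=> pos.
have [|l sr src] := @extract s (set12 false p K).
  by move=> v v2; rewrite st1_set12 st2_set12 set12_right //; case: (pos v v2).
have [|l' rr' rrc] := @extract l (set12 true (~~ p) K).
  move=> v v2; rewrite st1_set12 st2_set12 set12_right //; case: (pos v v2) => _.
  by rewrite src // cnt_cons st1_set12.
exists (set12 false (~~ p) K :: set12 true p K :: l').
  apply: cong_trans sr _; apply: cong_trans (cong_quadric _ _ _).
  rewrite -cat1s -[X in cong _ X]cat1s.
  apply: cong_trans (cong_perm _) (cong_trans (cong_cat [:: set12 false p K] rr') (cong_perm _));
    by rewrite perm_catC.
move=> i j v c v2; rewrite src // !cnt_cons rrc // !cnt_cons !st1_set12 !st2_set12 !set12_right //.
by case: i; case: j; case: {+}p; case: (_ == c) => /=; lia.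
Qed.

(** Each row and each column of the 2 by 2 array of blocks has one block that loses a unit along [K]
    and one that gains it. *)
Lemma same_toric_exchange s t s1 p K : same_toric s t ->
  (forall i j v c, (2 <= v)%N ->
    (cnt s1 i j v c + ((i (+) j == p) && (K v == c :> nat)) =
     cnt s i j v c + ((i (+) j != p) && (K v == c :> nat)))%N) ->
  same_toric s1 t.
Proof.
move=> st E v c v2; have [st1 st2] := st v c v2.
move: (E false false v c v2) (E false true v c v2) (E true false v c v2) (E true true v c v2).
move: (st1 false) (st1 true) (st2 false) (st2 true).
by case: p {E}; case: (_ == c) => /= *; split=> -[]; lia.
Qed.

Lemma same_toric_sym s t : same_toric s t -> same_toric t s.
Proof. by move=> st v c v2; have [st1 st2] := st v c v2; split=> *; rewrite ?st1 ?st2. Qed.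

(* The block 11 suffices: same_toric determines the other three. *)
Definition dist s t : nat :=
  (\sum_(u : {v : 'I_N & 'I_(d v)} | (2 <= tag u)%N)
    ((cnt s false false (tag u) (tagged u) - cnt t false false (tag u) (tagged u)) +
     (cnt t false false (tag u) (tagged u) - cnt s false false (tag u) (tagged u))))%N.

Definition tot s i j : nat := count (fun x => (st1 x == i) && (st2 x == j)) s.

Lemma sum_cnt s i j v : (\sum_(c < d v) cnt s i j v c = tot s i j)%N.
Proof.
elim: s => [|x s IHs]; first by rewrite big1.
under eq_bigr do rewrite cnt_cons.
rewrite big_split /= {}IHs; congr (_ + _)%N.
rewrite (bigD1 (x v)) //= eqxx andbT big1 ?addn0 // => c /negbTE cx.
by rewrite -val_eqE /= in cx; rewrite eq_sym in cx; rewrite cx !andbF.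
Qed.

Lemma cnt_ge s i j v c : (d v <= c)%N -> cnt s i j v c = 0%N.
Proof.
move=> dc; apply/eqP; rewrite -leqn0 leqNgt -has_count; apply/hasP => -[x _ /and3P[_ _ /eqP xv]].
by have := ltn_ord (x v); rewrite xv ltnNge dc.
Qed.

(** A 2 by 2 table with given row and column sums is determined by one entry. *)
Lemma same_toric_cell s t i0 j0 : same_toric s t ->
  (forall v (c : 'I_(d v)), (2 <= v)%N -> cnt s i0 j0 v c = cnt t i0 j0 v c) -> same_cnt s t.
Proof.
move=> st E i j v c v2; have [cd|dc] := ltnP c (d v); last by rewrite !cnt_ge.
have [st1 st2] := st v c v2; have := E v (Ordinal cd) v2 => /=.
move: (st1 false) (st1 true) (st2 false) (st2 true).
by case: i0 j0 i j {E} => [] [] [] []; lia.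
Qed.

(* Some quadric p_{1jK} p_{2j'K} with {j, j'} = {1, 2} (j = 1 iff p = false)
   divides a monomial in the Segre class of s. *)
Definition nonisolated p s : bool := [forall v : 'I_N, (2 <= v)%N ==>
  [exists c : 'I_(d v), (0 < cnt s false p v c)%N && (0 < cnt s true (~~ p) v c)%N]].

Lemma choose_state (Q : forall v, 'I_(d v) -> Prop) :
  (forall v, (2 <= v)%N -> exists c, Q v c) -> exists K, forall v, (2 <= v)%N -> Q v (K v).
Proof.
move=> ex; have [|f fQ] := @fin_all_exists _ (fun v => 'I_(d v)) (fun v c => (2 <= v)%N -> Q v c).
  move=> v; case: (leqP 2 v) => [/ex[c Qc]|v1]; first by exists c.
  by have d0 : (0 < d v)%N; [rewrite hd12|exists (Ordinal d0)].
by exists (finfun f) => v v2; rewrite ffunE; apply: fQ.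
Qed.

Lemma same_toric_other s t p v c : (2 <= v)%N -> same_toric s t ->
  [/\ (cnt s true p v c + cnt s false p v c = cnt t true p v c + cnt t false p v c)%N,
      (cnt s false (~~ p) v c + cnt s false p v c =
       cnt t false (~~ p) v c + cnt t false p v c)%N
    & (cnt s true (~~ p) v c + cnt t false p v c = cnt t true (~~ p) v c + cnt s false p v c)%N].
Proof.
move=> v2 st; have [st1 st2] := st v c v2.
by move: (st1 false) (st1 true) (st2 false) (st2 true); case: p => /=; split; lia.
Qed.

(** The quadric just applied can be undone along the same [K], so the new monomial admits a quadric
    of the opposite direction. *)
Lemma exchange_step p K s t : same_toric s t ->
  (forall v, (2 <= v)%N -> (0 < cnt s false p v (K v))%N /\ (0 < cnt s true (~~ p) v (K v))%N) ->
  exists s1, [/\ cong s s1, same_toric s1 t, nonisolated (~~ p) s1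
    & forall i j v c, (2 <= v)%N ->
        (cnt s1 i j v c + ((i (+) j == p) && (K v == c :> nat)) =
         cnt s i j v c + ((i (+) j != p) && (K v == c :> nat)))%N].
Proof.
move=> st pos; have [s1 ss1 s1c] := exchange pos.
exists s1; split=> //; first exact: same_toric_exchange st s1c.
apply/forallP => v; apply/implyP => v2; apply/existsP; exists (K v).
have := s1c false (~~ p) v (K v) v2; have := s1c true p v (K v) v2; rewrite eqxx negbK.
by case: {+}p => /=; lia.
Qed.

(** At every node some state is in excess in block [(false, p)], and then equally so in the opposite
    block [(true, ~~ p)]. A quadric along such states brings [s] closer to [t]. *)
Lemma cnt_lt_step p s t : same_toric s t -> (tot t false p < tot s false p)%N ->
  exists s1, [/\ cong s s1, same_toric s1 t, nonisolated (~~ p) s1 & (dist s1 t < dist s t)%N].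
Proof.
move=> st lt; have [|K Kp] := @choose_state (fun v c => cnt t false p v c < cnt s false p v c)%N.
  move=> v v2; apply/existsP; apply: contraLR lt; rewrite negb_exists => /forallP le.
  by rewrite -leqNgt -!(sum_cnt _ _ _ v); apply: leq_sum => c _; rewrite leqNgt.
have [|s1 [ss1 s1t s1n s1c]] := @exchange_step p K s t st.
  move=> v v2; have := Kp v v2; have [] := same_toric_other p (K v) v2 st; lia.
exists s1; split=> //.
have step v (c : 'I_(d v)) : (2 <= v)%N -> ((cnt s1 false false v c - cnt t false false v c) +
     (cnt t false false v c - cnt s1 false false v c) + (K v == c :> nat) =
     (cnt s false false v c - cnt t false false v c) +
     (cnt t false false v c - cnt s false false v c))%N.
  move=> v2; have := Kp v v2; have := s1c false false v c v2.
  have [] := same_toric_other p (K v) v2 st.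
  case: (eqVneq (K v : nat) c) => [->|_]; last by rewrite !andbF; lia.
  by case: {+}p => /=; lia.
apply: (@ltn_sum1 _ _ _ _ (Tagged _ (K n3))) => // [[v c] /= v2|/=].
  by rewrite -(step v c v2) leq_addr.
by rewrite -(step n3) // eqxx addn1.
Qed.

(** Induction on the distance. If the block sizes differ, one quadric brings [s] closer. If they
    agree, one quadric is applied to [s] and one to [t], which keeps the sizes equal; nonisolation
    supplies the states at nodes where [s] and [t] already agree. *)
Lemma nonisolated_cong p s t : nonisolated p s -> same_toric s t -> cong s t.
Proof.
move: {2}_.+1 (ltnSn (dist s t)) => n; elim: n p s t => // n IHn p s t le_n ni st.
have sum_tot : (tot s false p + tot s false (~~ p) = tot t false p + tot t false (~~ p))%N.
  rewrite -!(sum_cnt _ _ _ n3) -!big_split; apply: eq_bigr => c _ /=.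
  by have [] := @same_toric_other s t p n3 c isT st; lia.
case: (ltngtP (tot s false p) (tot t false p)) => [lt|lt|eq_tot].
- have [|s1 [ss1 s1t s1n lt1]] := @cnt_lt_step (~~ p) s t st; first by lia.
  by apply: cong_trans ss1 _; apply: IHn s1n s1t; lia.
- have [s1 [ss1 s1t s1n lt1]] := @cnt_lt_step p s t st lt.
  by apply: cong_trans ss1 _; apply: IHn s1n s1t; lia.
pose same v := [forall c : 'I_(d v), cnt s false p v c == cnt t false p v c].
case: (boolP [forall v : 'I_N, (2 <= v)%N ==> same v]) => [/forallP sm|].
  apply: same_cnt_cong; apply: (same_toric_cell st (i0 := false) (j0 := p)) => v c v2.
  by have /implyP/(_ v2)/forallP/(_ c)/eqP := sm v.
rewrite negb_forall => /existsP[v0]; rewrite negb_imply => /andP[v02 nsm].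
pose Q v (c c' : 'I_(d v)) :=
  [/\ (0 < cnt s false p v c)%N, (0 < cnt s true (~~ p) v c)%N,
      (0 < cnt t false p v c')%N, (0 < cnt t true (~~ p) v c')%N
    & if same v then c = c' else (cnt t false p v c < cnt s false p v c)%N /\
        (cnt s false p v c' < cnt t false p v c')%N].
have choice v : (2 <= v)%N -> exists c c', Q v c c'.
  rewrite /Q => v2; case: (boolP (same v)) => [sm|nsv].
    have /forallP/(_ v) := ni; rewrite v2 => /existsP[c /andP[c1 c2]].
    exists c, c; have /forallP/(_ c)/eqP := sm; have [] := same_toric_other p c v2 st.
    by split=> //; lia.
  have [|c' lt_c'] := @sum_eq_exists_lt _ (fun c : 'I_(d v) => cnt s false p v c)
    (fun c => cnt t false p v c) _ nsv; first by rewrite !sum_cnt.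
  have [||c lt_c] := @sum_eq_exists_lt _ (fun c : 'I_(d v) => cnt t false p v c)
    (fun c => cnt s false p v c); first by rewrite !sum_cnt.
    by rewrite (eq_forallb (fun c => eq_sym _ _)).
  exists c, c'; have [] := same_toric_other p c v2 st; have [] := same_toric_other p c' v2 st.
  by split=> //; lia.
have [|K KQ] := @choose_state (fun v c => exists c', Q v c c'); first exact: choice.
have [|K' {}KQ] := @choose_state (fun v c' => Q v (K v) c'); first exact: KQ.
have [|s1 [ss1 s1t s1n s1c]] := @exchange_step p K s t st.
  by move=> v /KQ[].
have [|t1 [tt1 t1s1 _ t1c]] := @exchange_step p K' t s1 (same_toric_sym s1t).
  by move=> v /KQ[].
apply: cong_trans ss1 _; apply: cong_trans (cong_sym tt1).
apply: IHn s1n (same_toric_sym t1s1).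
rewrite ltnS in le_n; apply: leq_trans le_n.
(* Where the blocks agree, both moves use the same state and cancel. Elsewhere the difference falls
   by one at [K v] and at [K' v]; the drop at [K v0] suffices. *)
have step v (c : 'I_(d v)) : (2 <= v)%N ->
    ((cnt s1 false false v c - cnt t1 false false v c) +
     (cnt t1 false false v c - cnt s1 false false v c) + (~~ same v && (K v == c :> nat)) <=
     (cnt s false false v c - cnt t false false v c) +
     (cnt t false false v c - cnt s false false v c))%N.
  move=> v2; have [_ _ _ _ KK'] := KQ v v2.
  have := s1c false false v c v2; have := t1c false false v c v2.
  have [] := same_toric_other p (K v) v2 st; have [] := same_toric_other p (K' v) v2 st.
  case: ifP KK' => [_ ->|_ [lt lt']].
    by case: (eqVneq (K' v : nat) c) => _; case: {+}p => /=; lia.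
  move: lt lt'.
  case: (eqVneq (K v : nat) c) => [->|_]; case: (eqVneq (K' v : nat) c) => [->|_]; case: {+}p => /=; lia.
apply: (@ltn_sum1 _ _ _ _ (Tagged _ (K v0))) => // [[v c] /= v2|/=].
  by apply: leq_trans (step v c v2); rewrite leq_addr.
by have := step v0 (K v0) v02; rewrite nsm eqxx addn1.
Qed.

(** * Exponents read off the toric parametrization *)

Local Notation toric_map := (@clique_monomial k 'I_N d (@K2 N)).

Lemma toric_monomial x : toric_map x = 0 \/ exists m, toric_map x = 'X_[m].
Proof.
right; rewrite /clique_monomial /theta.
elim/big_ind: _ => [|f g [m ->] [m' ->]|W _]; first by exists 0%MM; rewrite mpolyX0.
  by exists (m + m')%MM; rewrite mpolyXD.
by eexists.
Qed.

Lemma toric_neq0 s : subst toric_map (mon k s) != 0.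
Proof.
rewrite subst_mon prodf_seq_neq0; apply/allP => x _.
apply/prodf_neq0 => W _; by rewrite /theta -msupp_eq0 msuppX.
Qed.

Lemma clique_pair u v : (u < 2)%N -> (2 <= v)%N -> clique (@K2 N) [set u; v].
Proof.
move=> u1 v2; apply/forallP => w; apply/implyP => wW.
apply/forallP => w'; apply/implyP => w'W; apply/implyP.
move: wW w'W; rewrite !inE /K2 => /orP[] /eqP-> /orP[] /eqP->; rewrite ?eqxx // => _.
  by rewrite u1 ltnNge v2.
by rewrite u1 ltnNge v2.
Qed.

Lemma toric_count s t u v (b c : nat) : (u < 2)%N -> (2 <= v)%N ->
  subst toric_map (mon k s) = subst toric_map (mon k t) ->
  count (fun x => (x u == b :> nat) && (x v == c :> nat)) s =
  count (fun x => (x u == b :> nat) && (x v == c :> nat)) t.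
Proof.
move=> u1 v2; rewrite !subst_mon /clique_monomial /theta => E.
pose W0 := [set u; v].
(* The parameter of the edge [W0] with states [b] and [c], described through a state restricting to
   it; no other clique contributes to the count. *)
pose q (m : param d) := [exists x : st,
  [&& m == Tagged (state_on d) (restr W0 x), x u == b :> nat & x v == c :> nat]].
have := prod_vars_count q E.
have sumE l : (\sum_(x <- l) \sum_(W | clique (@K2 N) W) q (Tagged (state_on d) (restr W x)) =
    count (fun x => (x u == b :> nat) && (x v == c :> nat)) l)%N; last by rewrite !sumE.
rewrite -sum1_count [RHS]big_mkcond; apply: eq_bigr => x _.
rewrite (bigD1 W0) ?clique_pair //= big1 ?addn0 => [|W /andP[_ WW0]]; last first.
  apply/eqP; rewrite eqb0; apply/existsP => -[y /and3P[/eqP/(congr1 tag)/= E' _ _]].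
  by rewrite E' eqxx in WW0.
suff -> : q (Tagged (state_on d) (restr W0 x)) = (x u == b :> nat) && (x v == c :> nat) by case: andb.
apply/existsP/idP => [[y /and3P[]]|/andP[xb xc]]; last by exists x; rewrite eqxx xb xc.
rewrite eq_Tagged /= => /eqP /ffunP xy.
have uW : u \in W0 by rewrite !inE eqxx.
have vW : v \in W0 by rewrite !inE eqxx orbT.
have := xy (Sub u uW); have := xy (Sub v vW); rewrite !ffunE /= => -> -> -> ->.
by [].
Qed.

Lemma toric_same_toric s t :
  subst toric_map (mon k s) = subst toric_map (mon k t) -> same_toric s t.
Proof.
move=> E v c v2; split=> [i|j].
- have cntE l : (cnt l i false v c + cnt l i true v c)%N =
      count (fun x => (x n1 == i :> nat) && (x v == c :> nat)) l.
    rewrite -sum1_count /cnt -!sum1_count big_mkcond [X in (_ + X)%N]big_mkcond -big_split.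
    rewrite [RHS]big_mkcond; apply: eq_bigr => x _ /=.
    have := state_left x (isT : n1 < 2)%N; rewrite /st1.
    by case: (_ == c); case: (st2 x); case: {+}i; case: (nat_of_ord _) => [|[]].
  by rewrite !cntE; apply: toric_count.
- have cntE l : (cnt l false j v c + cnt l true j v c)%N =
      count (fun x => (x n2 == j :> nat) && (x v == c :> nat)) l.
    rewrite -sum1_count /cnt -!sum1_count big_mkcond [X in (_ + X)%N]big_mkcond -big_split.
    rewrite [RHS]big_mkcond; apply: eq_bigr => x _ /=.
    have := state_left x (isT : n2 < 2)%N; rewrite /st2.
    by case: (_ == c); case: (st1 x); case: {+}j; case: (nat_of_ord _) => [|[]].
  by rewrite !cntE; apply: toric_count.
Qed.

(** * Parametrization of the components *)

Implicit Types (q r : node_set d).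

Definition vanishing q r x : bool :=
  if st1 x == st2 x then (x (tag q) \in tagged q) == ~~ st1 x
  else (x (tag r) \in tagged r) == ~~ st1 x.

Lemma vanishing_stateE q r x : vanishing_state hN (tagged q) (tagged r) x = vanishing q r x.
Proof.
rewrite /vanishing_state /vanishing /st1 /st2.
have := state_left x (isT : n1 < 2)%N; have := state_left x (isT : n2 < 2)%N.
case: (nat_of_ord (x n1)) => [|[|//]]; case: (nat_of_ord (x n2)) => [|[|//]] _ _ /=;
  by rewrite ?orbF ?eqb_id ?eqbF_neg.
Qed.

(** The vanishing condition is attached to the node [a] or [b], so that each factor of [segre_map]
    depends on nodes 1, 2 and [v] only, as [prod_glue] requires. *)
Definition vanishing_at q r v x : bool :=
  [|| [&& v == tag q, st1 x == st2 x & (x (tag q) \in tagged q) == ~~ st1 x]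
    | [&& v == tag r, st1 x != st2 x & (x (tag r) \in tagged r) == ~~ st1 x]].

Definition segre_index : finType := ({v : 'I_N & 'I_(d v)} * (bool * bool))%type.

Definition segre_param v x : segre_index := (Tagged (fun v => 'I_(d v)) (x v), (st1 x, st2 x)).

(* The parametrization of P_{a,C,b,D}: on each of the four blocks fixed by the
   states of nodes 1 and 2, the Segre map with some of its factors set to 0. *)
Definition segre_map q r x : {mpoly k[#|segre_index|]} :=
  \prod_(v : 'I_N | (2 <= v)%N) if vanishing_at q r v x then 0 else 'X_(enum_rank (segre_param v x)).

Lemma segre_mapE q r x : (2 <= tag q)%N -> (2 <= tag r)%N ->
  segre_map q r x = if vanishing q r x then 0
                    else \prod_(v : 'I_N | (2 <= v)%N) 'X_(enum_rank (segre_param v x)).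
Proof.
move=> q2 r2; case: ifP; rewrite /vanishing => van.
  pose v := if st1 x == st2 x then tag q else tag r.
  have v2 : (2 <= v)%N by rewrite /v; case: ifP.
  rewrite /segre_map (bigD1 v) //= ifT ?mul0r // /vanishing_at /v.
  by move: van; case: ifP => _ ->; rewrite eqxx ?orbT.
apply: eq_bigr => v _; rewrite ifF // /vanishing_at.
by move: van; case: ifP => _ ->; rewrite /= !andbF.
Qed.

Lemma segre_monomial q r x : segre_map q r x = 0 \/ exists m, segre_map q r x = 'X_[m].
Proof.
rewrite /segre_map.
elim/big_ind: _ => [|f g|v _]; first by right; exists 0%MM; rewrite mpolyX0.
  move=> [->|[m ->]]; first by left; rewrite mul0r.
  move=> [->|[m' ->]]; first by left; rewrite mulr0.
  by right; exists (m + m')%MM; rewrite mpolyXD.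
by case: ifP; [left|right; eexists].
Qed.

Lemma segre_neq0 q r s : (2 <= tag q)%N -> (2 <= tag r)%N ->
  (subst (segre_map q r) (mon k s) != 0) = all (fun x => ~~ vanishing q r x) s.
Proof.
move=> q2 r2; rewrite subst_mon prodf_seq_neq0; apply: eq_all => x /=.
rewrite segre_mapE //; case: ifP; rewrite ?eqxx // => _.
by apply/prodf_neq0 => v _; rewrite -msupp_eq0 msuppX.
Qed.

Lemma segre_same_cnt q r s t : (2 <= tag q)%N -> (2 <= tag r)%N ->
  subst (segre_map q r) (mon k t) != 0 ->
  subst (segre_map q r) (mon k s) = subst (segre_map q r) (mon k t) -> same_cnt s t.
Proof.
move=> q2 r2 tN0 E i j v c v2.
have mapE l : subst (segre_map q r) (mon k l) != 0 -> subst (segre_map q r) (mon k l) =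
    \prod_(x <- l) \prod_(v : 'I_N | (2 <= v)%N) 'X_(enum_rank (segre_param v x))
      :> {mpoly k[#|segre_index|]}.
  rewrite segre_neq0 // subst_mon => /allP lN; apply: eq_big_seq => x xl.
  by rewrite segre_mapE // (negbTE (lN x xl)).
have sN0 : subst (segre_map q r) (mon k s) != 0 by rewrite E.
move: E; rewrite (mapE _ tN0) (mapE _ sN0) => E.
pose T (m : segre_index) := [&& tag m.1 == v, tagged m.1 == c :> nat & m.2 == (i, j)].
have := prod_vars_count T E.
have sumE l : (\sum_(x <- l) \sum_(w : 'I_N | (2 <= w)%N) T (segre_param w x) = cnt l i j v c)%N;
  last by rewrite !sumE.
rewrite /cnt -sum1_count [RHS]big_mkcond; apply: eq_bigr => x _.
rewrite (bigD1 v) //= big1 ?addn0 => [|w /andP[_ /negbTE wv]]; last by rewrite /T /= wv.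
by rewrite /T /= eqxx xpair_eqE /= [X in nat_of_bool X]andbC -andbA; case: [&& _, _ & _].
Qed.

Local Notation Pid q r := (@P_ideal k N hN d _ (tagged q) _ (tagged r)).

Lemma ideal_P q r : ideal (Pid q r).
Proof. exact: ideal_genP. Qed.

Lemma global_markov_sub_P q r f : I f -> Pid q r f.
Proof. by move=> If; apply: sub_ideal_gen; left. Qed.

(** Along one $K$, exactly one of $p_{11K}, p_{22K}$ vanishes, according to whether $K_a \in C$, and
    likewise for $p_{12K}, p_{21K}$ with $D$. So both products are 0, unless node 1 or node 2 keeps
    its state and the relation is trivial. *)
Lemma segre_quadric q r y0 y1 y2 y3 : (2 <= tag q)%N -> (2 <= tag r)%N ->
  [/\ st1 y1 = st1 y0, st1 y3 = st1 y2, st2 y2 = st2 y0 & st2 y3 = st2 y1] ->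
  (forall v, (2 <= v)%N -> [/\ y1 v = y0 v, y2 v = y0 v & y3 v = y0 v]) ->
  segre_map q r y0 * segre_map q r y3 = segre_map q r y1 * segre_map q r y2.
Proof.
move=> q2 r2 [e1 e2 e3 e4] er.
have [E|D1] := eqVneq (st1 y0) (st1 y2).
  have -> : y3 = y1 by apply: st_eq => [||v /er[-> _ ->]] //; rewrite e2 -E.
  have -> : y2 = y0 by apply: st_eq => [||v /er[_ -> _]].
  by rewrite mulrC.
have [E|D2] := eqVneq (st2 y0) (st2 y1).
  have -> : y3 = y2 by apply: st_eq => [||v /er[_ -> ->]] //; rewrite e4 -E.
  by have -> : y1 = y0 by apply: st_eq => [||v /er[-> _ _]].
have [q1 q2' q3] := er _ q2; have [r1 r2' r3] := er _ r2.
rewrite !segre_mapE // /vanishing e1 e2 e3 e4 q1 q2' q3 r1 r2' r3.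
move: D1 D2; case: (st1 y0); case: (st1 y2); case: (st2 y0); case: (st2 y1) => //= _ _;
  by do 2?[case: (_ \in _)]; rewrite /= ?mul0r ?mulr0.
Qed.

(** If [A] and [B] separate node 1 from node 2, neither contains a further node, and the binomial is
    a quadric along one $K$. Otherwise no set $\{1,2,v\}$ meets both [A] and [B]. *)
Lemma segre_markov q r f : (2 <= tag q)%N -> (2 <= tag r)%N -> I f -> subst (segre_map q r) f = 0.
Proof.
move=> q2 r2; apply: (ideal_gen_min (J := fun f => subst (segre_map q r) f = 0)).
  by case: (ker_prime (segre_map q r)).
move=> _ [A [B [C [x [x' [[dAB dAC dBC ABC] sep ->]]]]]].
rewrite substB !pvarM !subst_mon !big_cons !big_nil !mulr1.
apply/eqP; rewrite subr_eq0; apply/eqP.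
have edge u v : u \in A -> v \in B -> ~~ K2 u v := separates_edge dAC dBC sep.
have edgeA u v : u \in A -> (u < 2)%N -> (2 <= v)%N -> v \in B = false.
  by move=> uA u1 v2; apply/negP => /(edge _ _ uA); rewrite /K2 u1 ltnNge v2.
have edgeB u v : u \in B -> (u < 2)%N -> (2 <= v)%N -> v \in A = false.
  by move=> uB u1 v2; apply/negP => vA; have := edge _ _ vA uB; rewrite /K2 u1 ltnNge v2.
have [/andP[h1 h2]|nsp] := boolP ((n1 \in A) && (n2 \in B)).
  apply: segre_quadric q2 r2 _ _.
    by rewrite !st1_glue !st2_glue !inE h1 h2 (disjointFr dAB h1) (disjointFl dAB h2) orbT.
  by move=> v v2; rewrite !ffunE inE (edgeA _ _ h1) // (edgeB _ _ h2).
have [/andP[h1 h2]|nsp'] := boolP ((n1 \in B) && (n2 \in A)).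
  rewrite [RHS]mulrC; apply: segre_quadric q2 r2 _ _.
    by rewrite !st1_glue !st2_glue !inE h1 h2 (disjointFl dAB h1) (disjointFr dAB h2) orbT.
  by move=> v v2; rewrite !ffunE inE (edgeA _ _ h2) // (edgeB _ _ h1).
apply: (@prod_glue _ _ _ _ _ (fun v => [set n1; n2; v])
  (fun v x => if vanishing_at q r v x then 0 else 'X_(enum_rank (segre_param v x)))).
  move=> v y z v2 yz.
  have y1 : y n1 = z n1 by apply: yz; rewrite !inE eqxx.
  have y2 : y n2 = z n2 by apply: yz; rewrite !inE eqxx orbT.
  have yv : y v = z v by apply: yz; rewrite !inE eqxx orbT.
  have van : vanishing_at q r v y = vanishing_at q r v z.
    rewrite /vanishing_at /st1 /st2 y1 y2; congr orb.
      by case: eqP => //= E; rewrite (yz (tag q)) // !inE E eqxx orbT.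
    by case: eqP => //= E; rewrite (yz (tag r)) // !inE E eqxx orbT.
  by rewrite van /segre_param yv /st1 /st2 y1 y2.
move=> v v2; apply/norP => -[/pred0Pn[u /= /andP[uW uA]] /pred0Pn[u' /= /andP[u'W u'B]]].
move: uW u'W; rewrite !inE -!orbA => /or3P[] /eqP E /or3P[] /eqP E'; subst u u'.
- by rewrite (disjointFr dAB uA) in u'B.
- by rewrite uA u'B in nsp.
- by rewrite (edgeA _ _ uA) in u'B.
- by rewrite uA u'B in nsp'.
- by rewrite (disjointFr dAB uA) in u'B.
- by rewrite (edgeA _ _ uA) in u'B.
- by rewrite (edgeB _ _ u'B) in uA.
- by rewrite (edgeB _ _ u'B) in uA.
- by rewrite (disjointFr dAB uA) in u'B.
Qed.

(** A monomial with a vanishing factor lies in the ideal. For any other one, the fibre of the map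
    lies in a Segre class, whose binomials are in the Markov ideal. *)
Lemma P_idealE q r f : (2 <= tag q)%N -> (2 <= tag r)%N ->
  Pid q r f <-> subst (segre_map q r) f = 0.
Proof.
move=> q2 r2.
have P0 g : Pid q r g -> subst (segre_map q r) g = 0.
  apply: (ideal_gen_min (J := fun g => subst (segre_map q r) g = 0)).
    by case: (ker_prime (segre_map q r)).
  move=> h [/(segre_markov q2 r2)//|[x]].
  rewrite vanishing_stateE => van ->; have -> : pvar k x = mon k [:: x] by rewrite /mon big_seq1.
  by rewrite subst_mon big_seq1 segre_mapE // van.
split; first exact: P0.
move: f; apply: ideal_by_fibers (@ideal_P q r) _ P0 _; first by case: (ker_prime (segre_map q r)).
move=> m; rewrite -mon_seq_of; set s := seq_of m.
have [sN0|] := boolP (all (fun x => ~~ vanishing q r x) s); last first.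
  rewrite -has_predC => /hasP[x xs /negPn van]; left.
  rewrite /mon (perm_big _ (perm_to_rem xs)) big_cons; apply: ideal_mulr (@ideal_P q r) _.
  by apply: sub_ideal_gen; right; exists x; rewrite ?vanishing_stateE.
rewrite -(segre_neq0 _ q2 r2) in sN0; right.
exists (fun m' => subst (segre_map q r) 'X_[m'] == subst (segre_map q r) 'X_[m]); split=> //.
  move=> m' /eqP E; apply: global_markov_sub_P; rewrite -(mon_seq_of k m').
  apply: same_cnt_cong; apply: segre_same_cnt q2 r2 sN0 _.
  by rewrite !mon_seq_of.
move=> f f0; apply: ker_fiber_sum f0 _; first exact: segre_monomial.
by rewrite -mon_seq_of.
Qed.

(** * Monomials to which no quadric applies *)

Lemma same_toric_tot s t : same_toric s t ->
  (forall i, tot s i false + tot s i true = tot t i false + tot t i true)%N /\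
  (forall j, tot s false j + tot s true j = tot t false j + tot t true j)%N.
Proof.
move=> E; split=> i; rewrite -!(sum_cnt _ _ _ n3) -!big_split; apply: eq_bigr => c _ /=;
  by case: (E n3 c isT).
Qed.

(** From [s] to [t] opposite blocks change by the same amount, and one of the two starts at 0. *)
Lemma isolated_le p s t v : (2 <= v)%N -> same_toric s t ->
  (forall c : 'I_(d v), (cnt s false p v c == 0%N) || (cnt s true (~~ p) v c == 0%N)) ->
  (forall c : 'I_(d v), cnt s false p v c <= cnt t false p v c)%N.
Proof.
move=> v2 E iso c; have := iso c; have [] := same_toric_other p c v2 E; lia.
Qed.

(* The disjointness at a lets block 11 only grow inside a toric fibre, the one
   at b lets block 12 only grow; the sum of the two sizes is fixed. *)
Lemma isolated_fiber s t a b : (2 <= a)%N -> (2 <= b)%N -> same_toric s t ->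
  (forall c : 'I_(d a), (cnt s false false a c == 0%N) || (cnt s true true a c == 0%N)) ->
  (forall c : 'I_(d b), (cnt s false true b c == 0%N) || (cnt s true false b c == 0%N)) ->
  [/\ forall i j, tot s i j = tot t i j,
      forall c : 'I_(d a), cnt s false false a c = cnt t false false a c
    & forall c : 'I_(d b), cnt s false false b c = cnt t false false b c].
Proof.
move=> a2 b2 E isoa isob; have [T1 T2] := same_toric_tot E.
have le_a := @isolated_le false s t a a2 E isoa.
have le_b := @isolated_le true s t b b2 E isob.
have leT0 : (tot s false false <= tot t false false)%N.
  by rewrite -!(sum_cnt _ _ _ a); apply: leq_sum.
have leT1 : (tot s false true <= tot t false true)%N.
  by rewrite -!(sum_cnt _ _ _ b); apply: leq_sum.
have Tf := T1 false.
split.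
- move: (T1 false) (T1 true) (T2 false) (T2 true) leT0 leT1 => ?????? [] []; lia.
- by apply: leq_sum_eq le_a _; rewrite !sum_cnt; lia.
have Eb : forall c : 'I_(d b), cnt s false true b c = cnt t false true b c.
  by apply: leq_sum_eq le_b _; rewrite !sum_cnt; lia.
by move=> c; have [/(_ false) + _] := E b c b2; rewrite Eb; lia.
Qed.

Lemma tot0_cnt s i j v c : tot s i j = 0%N -> cnt s i j v c = 0%N.
Proof.
move=> /eqP; rewrite -leqn0 => T0; apply/eqP; rewrite -leqn0; apply: leq_trans T0.
by apply: sub_count => x /and3P[-> ->].
Qed.

Lemma toric_fiber_or_component s :
  (forall t, same_toric s t -> cong s t) \/
  exists q r, [/\ proper_node_set q, proper_node_set r, (N == 4) ==> (tag q == tag r)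
                & all (fun x => ~~ vanishing q r x) s].
Proof.
have [ni|] := boolP (nonisolated false s).
  by left=> t; apply: (@nonisolated_cong false).
rewrite negb_forall => /existsP[a]; rewrite negb_imply negb_exists => /andP[a2 /forallP isoa].
have [ni|] := boolP (nonisolated true s).
  by left=> t; apply: (@nonisolated_cong true).
rewrite negb_forall => /existsP[b]; rewrite negb_imply negb_exists => /andP[b2 /forallP isob].
have {}isoa (c : 'I_(d a)) : (cnt s false false a c == 0%N) || (cnt s true true a c == 0%N).
  by have := isoa c; rewrite negb_and -!leqNgt !leqn0.
have {}isob (c : 'I_(d b)) : (cnt s false true b c == 0%N) || (cnt s true false b c == 0%N).
  by have := isob c; rewrite negb_and -!leqNgt !leqn0.
have fiber t E := @isolated_fiber s t a b a2 b2 E isoa isob.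
(* Block sizes are constant on the fibre, so an empty block stays empty and determines the other
   three. *)
have [/existsP[i /existsP[j /eqP T0]]|totN0] := boolP [exists i, exists j, tot s i j == 0%N].
  left=> t E; apply: same_cnt_cong; apply: (same_toric_cell E (i0 := i) (j0 := j)).
  by have [T _ _] := fiber t E; move=> v c v2; rewrite !tot0_cnt // -T.
(* Here [a] and [b] are all the nodes besides 1 and 2, and block 11 is fixed at both. *)
have [/andP[/eqP N4 ab]|N4ab] := boolP ((N == 4) && (a != b)).
  left=> t E; apply: same_cnt_cong.
  apply: (same_toric_cell E (i0 := false) (j0 := false)) => v c v2.
  have [_ Ea Eb] := fiber t E.
  have [va|va] := eqVneq v a; first by move: c; rewrite va; apply: Ea.
  have [vb|vb] := eqVneq v b; first by move: c; rewrite vb; apply: Eb.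
  have := ltn_ord a; have := ltn_ord b; have := ltn_ord v; move: ab va vb.
  by rewrite -!val_eqE /=; lia.
(* With all four blocks nonempty, the supports of blocks 22 and 21 make $C$ and $D$ nonempty, those
   of 11 and 12 make them proper. *)
right; have cell i j : exists2 x, x \in s & (st1 x == i) && (st2 x == j).
  apply/hasP; rewrite has_count lt0n; move: totN0; rewrite negb_exists => /forallP/(_ i).
  by rewrite negb_exists => /forallP/(_ j).
have cntx v x : x \in s -> cnt s (st1 x) (st2 x) v (x v) != 0%N.
  by move=> xs; rewrite -lt0n -has_count; apply/hasP; exists x; rewrite ?eqxx.
have cntE i j v x : x \in s -> (st1 x == i) && (st2 x == j) -> cnt s i j v (x v) != 0%N.
  by move=> xs /andP[/eqP<- /eqP<-]; apply: cntx.
exists (Tagged (fun v => {set 'I_(d v)}) [set c : 'I_(d a) | cnt s true true a c != 0%N]).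
exists (Tagged (fun v => {set 'I_(d v)}) [set c : 'I_(d b) | cnt s true false b c != 0%N]).
split.
- rewrite /proper_node_set /= a2 /=; apply/andP; split.
    by have [x xs xc] := cell true true; apply/set0Pn; exists (x a); rewrite inE cntE.
  rewrite properT; have [x xs xc] := cell false false; apply/eqP => /setP/(_ (x a)).
  by rewrite !inE; have := isoa (x a); rewrite (negbTE (cntE _ _ a x xs xc)) /= => ->.
- rewrite /proper_node_set /= b2 /=; apply/andP; split.
    by have [x xs xc] := cell true false; apply/set0Pn; exists (x b); rewrite inE cntE.
  rewrite properT; have [x xs xc] := cell false true; apply/eqP => /setP/(_ (x b)).
  by rewrite !inE; have := isob (x b); rewrite (negbTE (cntE _ _ b x xs xc)) /= => ->.
- by apply/implyP => N4; move: N4ab; rewrite N4 /= negbK.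
apply/allP => x xs; rewrite /vanishing /= !inE.
have := cntx a x xs; have := cntx b x xs; have := isoa (x a); have := isob (x b).
by case: (st1 x); case: (st2 x) => /=; do ?case: eqP.
Qed.

(** * Primality and the intersection *)

Lemma component_prime (j : component_index d) : admissible j -> prime_ideal (@component k N hN d j).
Proof.
case: j => [[q r] /and3P[/and3P[q2 _ _] /and3P[r2 _ _] _]|_]; last exact: (ker_prime toric_map).
have PE f := @P_idealE q r f q2 r2.
have [[K0 KD KM] K1 Kp] := ker_prime (segre_map q r).
split; [split| |] => /=.
- by apply/PE.
- by move=> f g /PE f0 /PE g0; apply/PE/KD.
- by move=> h f /PE f0; apply/PE/KM.
- by move/PE.
- by move=> f g /PE/Kp[]/PE; [left|right].
Qed.

Lemma global_markov_sub_component (j : component_index d) f : I f -> @component k N hN d j f.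
Proof.
case: j => [[q r]|] If; first exact: global_markov_sub_P.
apply: (ideal_gen_min (J := toric_ideal (@K2 N))) If; first by case: (ker_prime toric_map).
by move=> g; apply: markov_binomial_toric.
Qed.

(** Each monomial is assigned one component whose map does not kill it and whose fibre through it
    lies in a single Markov class. *)
Lemma global_markov_decomposition f :
  (forall j : component_index d, admissible j -> @component k N hN d j f) -> I f.
Proof.
apply: (ideal_by_fibers (J := fun f =>
  forall j : component_index d, admissible j -> @component k N hN d j f)) => {f}.
- exact: global_markov_idealP.
- split=> [j /component_prime[[]]|f g Jf Jg j adm|h f Jf j adm] //.
    by have [[_ JD _] _ _] := component_prime adm; apply: JD; [apply: Jf|apply: Jg].
  by have [[_ _ JM] _ _] := component_prime adm; apply: JM; apply: Jf.
- by move=> f If j _; apply: global_markov_sub_component.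
move=> m; right; rewrite -mon_seq_of; set s := seq_of m.
have [fib|[q [r [qP rP N4 sN0]]]] := toric_fiber_or_component s.
  exists (fun m' => subst toric_map 'X_[m'] == subst toric_map 'X_[m]); split=> //.
    move=> m' /eqP E; rewrite -(mon_seq_of k m'); apply: cong_sym; apply: fib.
    by apply: toric_same_toric; rewrite /s !mon_seq_of E.
  move=> f /(_ None isT) f0; apply: ker_fiber_sum f0 _; first exact: toric_monomial.
  by rewrite -mon_seq_of toric_neq0.
have [/andP[q2 _] /andP[r2 _]] := (qP, rP).
rewrite -(segre_neq0 s q2 r2) in sN0.
exists (fun m' => subst (segre_map q r) 'X_[m'] == subst (segre_map q r) 'X_[m]); split=> //.
  move=> m' /eqP E; rewrite -(mon_seq_of k m').
  apply: same_cnt_cong; apply: segre_same_cnt q2 r2 sN0 _.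
  by rewrite !mon_seq_of.
move=> f /(_ (Some (q, r))) f0; apply: (ker_fiber_sum (@segre_monomial q r)).
  by apply/(P_idealE _ q2 r2)/f0/and3P.
by rewrite -mon_seq_of.
Qed.

(** * Irredundancy *)

Lemma state_exists : exists x : st, True.
Proof.
have [|K _] := @choose_state (fun v c => True); last by exists K.
move=> v v2; have d0 : (0 < d v)%N by apply: leq_trans (hd v2).
by exists (Ordinal d0).
Qed.

Lemma proper_node_set_mem q e : proper_node_set q -> exists c, (c \in tagged q) = e.
Proof.
case/and3P=> _ /set0Pn[c cq]; rewrite properT => qT.
case: e; first by exists c.
have /set0Pn[c'] : ~: tagged q != set0 by rewrite -setCT (inj_eq (@setC_inj _)).
by rewrite inE => /negbTE; exists c'.
Qed.

Lemma set_node_mem a (C : {set 'I_(d a)}) (c : 'I_(d a)) K :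
  (set_node a c K a \in C) = (c \in C).
Proof.
by rewrite (_ : set_node _ _ _ _ = c) //; apply: val_inj; exact: set_nodeE.
Qed.

Lemma vanishing_exists q r i j e : proper_node_set q -> proper_node_set r ->
  exists x, [/\ st1 x = i, st2 x = j & vanishing q r x = e].
Proof.
move=> qP rP; have [q2 r2] : (2 <= tag q)%N /\ (2 <= tag r)%N by case/and3P: qP; case/and3P: rP.
have [K _] := state_exists.
have [c cE] := proper_node_set_mem (e == ~~ i) qP.
have [c' cE'] := proper_node_set_mem (e == ~~ i) rP.
exists (set12 i j (if i == j then set_node (tag q) c K else set_node (tag r) c' K)).
rewrite /vanishing st1_set12 // st2_set12 //; split=> //.
case: ifP => ij; rewrite set12_right // ij set_node_mem ?cE ?cE'; by case: {+}e; case: {+}i.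
Qed.

Lemma node_set_eq q q' : proper_node_set q -> proper_node_set q' ->
  (forall x, (x (tag q') \in tagged q') = (x (tag q) \in tagged q)) -> q' = q.
Proof.
case: q q' => [a C] [a' C'] qP qP' E; have [K _] := state_exists.
have [aa'|aa'] := eqVneq a' a.
  subst a'; congr Tagged; apply/setP => c.
  by have /= := E (set_node a c K); rewrite !set_node_mem.
have [c cE] := proper_node_set_mem false qP; have [c' cE'] := proper_node_set_mem true qP'.
have /= := E (set_node a c (set_node a' c' K)).
by rewrite set_node_mem cE set_node_neq // set_node_mem cE'.
Qed.

(** Block 11 gives the inclusion of $C'$ in $C$, block 22 that of the complements; blocks 12 and 21
    do the same for $D'$ and $D$. *)
Lemma vanishing_determines q r q' r' :
  proper_node_set q -> proper_node_set r -> proper_node_set q' -> proper_node_set r' ->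
  (forall x, vanishing q' r' x -> vanishing q r x) -> (q', r') = (q, r).
Proof.
move=> qP rP qP' rP' sub.
have [q2 r2] : (2 <= tag q)%N /\ (2 <= tag r)%N by case/and3P: qP; case/and3P: rP.
have [q2' r2'] : (2 <= tag q')%N /\ (2 <= tag r')%N by case/and3P: qP'; case/and3P: rP'.
congr pair; apply: node_set_eq => // x.
  have := sub (set12 false false x); have := sub (set12 true true x).
  rewrite /vanishing !st1_set12 // !st2_set12 // !set12_right //=.
  by case: (_ \in tagged q'); case: (_ \in tagged q) => //= h1 h2; first [have := h1 isT | have := h2 isT].
have := sub (set12 false true x); have := sub (set12 true false x).
rewrite /vanishing !st1_set12 // !st2_set12 // !set12_right //=.
by case: (_ \in tagged r'); case: (_ \in tagged r) => //= h1 h2; first [have := h1 isT | have := h2 isT].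
Qed.

(* For c different from a and b, flipping the state of node c in four states,
   one in each block, is a toric relation between non-vanishing monomials. *)
Lemma toric_not_sub_P q r : proper_node_set q -> proper_node_set r ->
  (N == 4) ==> (tag q == tag r) ->
  exists2 g, toric_ideal (@K2 N) g & subst (segre_map q r) g != 0.
Proof.
move=> qP rP N4.
have [q2 r2] : (2 <= tag q)%N /\ (2 <= tag r)%N by case/and3P: qP; case/and3P: rP.
(* For $N \ge 5$ there are three nodes besides 1 and 2; for $N = 4$ there are two, but $a = b$. *)
have [c [c2 cq cr]] : exists c : 'I_N, [/\ (2 <= c)%N, c != tag q & c != tag r].
  have lt2 : (2 < N)%N by lia. have lt3 : (3 < N)%N by lia.
  have [h2|] := boolP ((Ordinal lt2 != tag q) && (Ordinal lt2 != tag r)).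
    by exists (Ordinal lt2); case/andP: h2.
  have [h3|] := boolP ((Ordinal lt3 != tag q) && (Ordinal lt3 != tag r)).
    by exists (Ordinal lt3); case/andP: h3.
  rewrite !negb_and !negbK -!val_eqE /= => h3 h2.
  have lt4 : (4 < N)%N by move: N4; rewrite -val_eqE /=; lia.
  exists (Ordinal lt4); rewrite -!val_eqE /=; split=> //; lia.
have xex i j := @vanishing_exists q r i j false qP rP.
have [X XP] : exists X : bool -> bool -> st, forall i j,
    [/\ st1 (X i j) = i, st2 (X i j) = j & vanishing q r (X i j) = false].
  have [x00 ?] := xex false false; have [x01 ?] := xex false true.
  have [x10 ?] := xex true false; have [x11 ?] := xex true true.
  by exists (fun i j => if i then (if j then x11 else x10) else if j then x01 else x00) => -[] [].
(* The state of [c] alternates over the blocks, so changing [e] can be compensated by changing [i]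
   alone or [j] alone. *)
pose Y e i j := set_node c (i (+) j (+) e) (X i j).
have Yc e i j : Y e i j c = i (+) j (+) e :> nat.
  by rewrite set_nodeE //; apply: leq_trans (hd c2); case: (_ (+) _).
have Y1 e i j : st1 (Y e i j) = i.
  by rewrite -[RHS](let: And3 h _ _ := XP i j in h) /st1 set_node_neq // -val_eqE /=; lia.
have Y2 e i j : st2 (Y e i j) = j.
  by rewrite -[RHS](let: And3 _ h _ := XP i j in h) /st2 set_node_neq // -val_eqE /=; lia.
have Yvan e i j : ~~ vanishing q r (Y e i j).
  have [h1 h2 /negbT] := XP i j; rewrite /vanishing h1 h2 Y1 Y2.
  by rewrite !set_node_neq // eq_sym.
pose L e := [:: Y e false false; Y e false true; Y e true false; Y e true true].
exists (mon k (L false) - mon k (L true)).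
  rewrite /toric_ideal -/(subst _ _) substB !subst_mon.
  rewrite ![\prod_(x <- _) _]exchange_big /=; apply/eqP; rewrite subr_eq0; apply/eqP.
  apply: eq_bigr => W /forallP clW; rewrite !big_cons !big_nil !mulr1.
  have restrE x y : (forall v, v \in W -> x v = y v) -> restr W x = restr W y.
    by move=> xy; apply/ffunP => v; rewrite !ffunE; apply/xy/valP.
  have [cW|cW] := boolP (c \in W); last first.
    have Ye i j : restr W (Y false i j) = restr W (Y true i j).
      apply: restrE => v vW; have vc : v != c by apply: contraNneq cW => <-.
      by rewrite !set_node_neq.
    by rewrite !Ye.
  (* A clique containing [c] has no further node beyond one of 1 and 2, hence ignores [i] or [j]. *)
  have Wc v : v \in W -> (2 <= v)%N -> v = c.
    move=> vW v2; move: (clW v); rewrite vW => /forallP/(_ c); rewrite cW /K2 /=.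
    by rewrite [(v < 2)%N]ltnNge [(c < 2)%N]ltnNge v2 c2 implybF negbK => /eqP.
  have [n1W|n1W] := boolP (n1 \in W).
    have n2W : n2 \notin W.
      by apply/negP => n2W; move: (clW n1); rewrite n1W => /forallP/(_ n2); rewrite n2W.
    have Ye i j : restr W (Y false i j) = restr W (Y true i (~~ j)).
      apply: restrE => v vW; case: (leqP 2 v) => [/(Wc _ vW)->|].
        by apply/val_inj; rewrite /= !Yc; case: i j => [] [].
      case/left_nodeE => E; last by rewrite -E vW in n2W.
      by rewrite E; apply: st1_inj => //; rewrite !Y1.
    by rewrite !Ye /=; ring.
  have Ye i j : restr W (Y false i j) = restr W (Y true (~~ i) j).
    apply: restrE => v vW; case: (leqP 2 v) => [/(Wc _ vW)->|].
      by apply/val_inj; rewrite /= !Yc; case: i j => [] [].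
    case/left_nodeE => E; first by rewrite -E vW in n1W.
    by rewrite E; apply: st2_inj => //; rewrite !Y2.
  by rewrite !Ye /=; ring.
rewrite substB subr_eq0; apply/eqP => E.
have LN0 : subst (segre_map q r) (mon k (L true)) != 0 by rewrite segre_neq0 //= !Yvan.
(* In block 11, state 0 of [c] occurs once in [L false] and never in [L true]. *)
have := segre_same_cnt q2 r2 LN0 E false false 0%N c2.
by rewrite /cnt /= !Y1 !Y2 !Yc.
Qed.

Lemma component_irredundant (j : component_index d) : admissible j ->
  exists f, (forall i : component_index d, admissible i -> i <> j -> @component k N hN d i f) /\ ~ I f.
Proof.
case: j => [[q r]|_]; last first.
  exists (mon k (enum st)); split; last first.
    move=> /(@global_markov_sub_component None)/eqP.
    by rewrite -[_ \mPo _]/(subst toric_map _) (negbTE (toric_neq0 _)).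
  move=> [[q r]|//] /and3P[qP rP _] _; have [/andP[q2 _] /andP[r2 _]] := (qP, rP).
  apply/(P_idealE _ q2 r2)/eqP/negPn; rewrite segre_neq0 //.
  have [x [_ _ xv]] := @vanishing_exists q r false false true qP rP.
  by apply/allPn; exists x; rewrite ?mem_enum // xv.
move=> /and3P[qP rP N4]; have [/andP[q2 _] /andP[r2 _]] := (qP, rP).
have [g gT gN0] := toric_not_sub_P qP rP N4.
pose m := mon k [seq x <- enum st | ~~ vanishing q r x].
have mN0 : subst (segre_map q r) m != 0 by rewrite segre_neq0 // filter_all.
exists (m * g); split; last first.
  by move=> /(segre_markov q2 r2)/eqP; rewrite substM mulf_eq0 (negbTE mN0) (negbTE gN0).
move=> [[q' r']|] adm ne; last first.
  have [[_ _ JM] _ _] := component_prime adm; exact: JM.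
have [/and3P[qP' rP' _]] := adm; have [/andP[q2' _] /andP[r2' _]] := (qP', rP').
apply/(P_idealE _ q2' r2'); rewrite substM; apply/eqP; rewrite mulf_eq0; apply/orP; left.
(* If no factor of [m] vanished for [(q', r')], its vanishing states would be among those of
   [(q, r)], and the two indices would coincide. *)
apply/negPn; rewrite segre_neq0 //; apply/negP => /allP all_nv; case: ne; congr Some.
apply: vanishing_determines => // x; apply: contraLR => xnv.
by apply: all_nv; rewrite mem_filter xnv mem_enum.
Qed.

End K2.

Theorem theorem6p5 (k : fieldType) (N : nat) (hN : (4 <= N)%N) (d : 'I_N -> nat)
  (hd12 : forall v : 'I_N, (v < 2)%N -> d v = 2)
  (hd : forall v : 'I_N, (2 <= v)%N -> (2 <= d v)%N) :
  radical_ideal (@global_markov_ideal k 'I_N d (@K2 N)) /\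
  irredundant_prime_decomposition
    (@global_markov_ideal k 'I_N d (@K2 N))
    (@admissible N d) (@component k N hN d).
Proof.
split; split.
- exact: global_markov_idealP.
- move=> f n If; apply: (@global_markov_decomposition k N hN d hd12) => j adm.
  apply: (prime_ideal_radical (component_prime k hN hd12 adm) (n := n)).
  exact: global_markov_sub_component.
- by move=> j; apply: component_prime.
- move=> f; split=> [If j _|]; first exact: global_markov_sub_component.
  exact: (@global_markov_decomposition k N hN d hd12).
- move=> j adm E; have [f [fi fI]] := component_irredundant k hN hd12 hd adm.
  by apply: fI; apply/E.
Qed.
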